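(* Let $(F,A)$ be a soft set over a quasigroup $(Q,\cdot,\backslash,/)$. Then the following statements are equivalent: (1) $(F,A)_{(Q,\cdot)}$ is a soft quasigroup; (2) $(F,A)_{(Q,\circledast)}$ is a soft quasigroup; (3) $(F,A)_{(Q,\backslash)}$ is a soft quasigroup; (4) $(F,A)_{(Q,/)}$ is a soft quasigroup; (5) $(F,A)_{(Q,\backslash\backslash)}$ is a soft quasigroup; (6) $(F,A)_{(Q,//)}$ is a soft quasigroup.
   Context: A quasigroup is a nonempty set $Q$ with a binary operation $\cdot$ such that for all $a,b\in Q$ each of the equations $a\cdot x=b$ and $y\cdot a=b$ has a unique solution in $Q$. A nonempty subset $H\subseteq Q$ is a subquasigroup if it is closed under the operation and is a quasigroup under the restricted operation. The five parastrophes of $(Q,\cdot)$ are the quasigroups on $Q$ with operations defined by: $x\backslash y=z\Leftrightarrow x\cdot z=y$; $x/y=z\Leftrightarrow z\cdot y=x$; $y\circledast x=z\Leftrightarrow x\cdot y=z$; $x//y=z\Leftrightarrow y/x=z\Leftrightarrow z\cdot x=y$; $x\backslash\backslash y=z\Leftrightarrow y\backslash x=z\Leftrightarrow y\cdot z=x$. A quasigroup $(Q,\cdot)$ is also written $(Q,\cdot,\backslash,/)$ with its division operations. A soft set $(F,A)$ over $Q$ consists of a set $A$ of parameters and a map $F:A\to 2^{Q}\setminus\{\emptyset\}$. For a quasigroup operation $\ast$ on $Q$, $(F,A)_{(Q,\ast)}$ denotes this soft set regarded over $(Q,\ast)$; it is a soft quasigroup if $F(a)$ is a subquasigroup of $(Q,\ast)$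 for all $a\in A$. *)

(* Defs.v *)
From mathcomp Require Import all_boot.
From mathcomp Require Import boolp classical_sets.
Set Implicit Arguments.
Unset Strict Implicit.
Unset Printing Implicit Defensive.
Local Open Scope classical_set_scope.

Definition is_quasigroup (Q : Type) (op : Q -> Q -> Q) : Prop :=
  [/\ inhabited Q,
      forall a b : Q, exists! x : Q, op a x = b &
      forall a b : Q, exists! y : Q, op y a = b].

(* The operation, rather than the carrier, is the key of the structure, since
   a single carrier bears several quasigroup operations at once. *)
Record quasigroup (Q : Type) : Type := Quasigroup {
  qmul :> Q -> Q -> Q;
  qmulP : is_quasigroup qmul }.

Section Parastrophes.
Variables (Q : Type) (q : quasigroup Q).

Lemma qsolr (a b : Q) : exists! x : Q, q a x = b.
Proof. by case: (qmulP q). Qed.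

Lemma qsoll (a b : Q) : exists! y : Q, q y a = b.
Proof. by case: (qmulP q). Qed.

Definition ldiv_op (x y : Q) : Q := sval (cid (qsolr x y)).
Definition rdiv_op (x y : Q) : Q := sval (cid (qsoll y x)).
Definition opp_op (x y : Q) : Q := q y x.

Lemma ldiv_opE (x y z : Q) : ldiv_op x y = z <-> q x z = y.
Proof.
rewrite /ldiv_op; case: cid => t [/= tP tU]; split=> [<- //|/tU //].
Qed.

Lemma rdiv_opE (x y z : Q) : rdiv_op x y = z <-> q z y = x.
Proof.
rewrite /rdiv_op; case: cid => t [/= tP tU]; split=> [<- //|/tU //].
Qed.

Lemma ldiv_opP : is_quasigroup ldiv_op.
Proof.
split=> [|a b|a b]; first by case: (qmulP q).
  by exists (q a b); split=> [|x /ldiv_opE //]; apply/ldiv_opE.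
have [y [yP yU]] := qsoll b a.
by exists y; split=> [|z /ldiv_opE /yU //]; apply/ldiv_opE.
Qed.

Lemma rdiv_opP : is_quasigroup rdiv_op.
Proof.
split=> [|a b|a b]; first by case: (qmulP q).
  have [y [yP yU]] := qsolr b a.
  by exists y; split=> [|z /rdiv_opE /yU //]; apply/rdiv_opE.
by exists (q b a); split=> [|x /rdiv_opE //]; apply/rdiv_opE.
Qed.

Lemma opp_opP : is_quasigroup opp_op.
Proof.
by split=> [|a b|a b]; [case: (qmulP q) | exact: qsoll | exact: qsolr].
Qed.

Definition ldiv : quasigroup Q := Quasigroup ldiv_opP.
Definition rdiv : quasigroup Q := Quasigroup rdiv_opP.
Definition opp : quasigroup Q := Quasigroup opp_opP.

End Parastrophes.

(* x \\ y = y \ x  and  x // y = y / x *)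
Definition opp_ldiv (Q : Type) (q : quasigroup Q) : quasigroup Q :=
  opp (ldiv q).
Definition opp_rdiv (Q : Type) (q : quasigroup Q) : quasigroup Q :=
  opp (rdiv q).

Section ParastropheSpecs.
Variables (Q : Type) (q : quasigroup Q).
Implicit Types x y z : Q.

Lemma ldivE x y z : ldiv q x y = z <-> q x z = y.
Proof. exact: ldiv_opE. Qed.

Lemma rdivE x y z : rdiv q x y = z <-> q z y = x.
Proof. exact: rdiv_opE. Qed.

Lemma oppE x y z : opp q y x = z <-> q x y = z.
Proof. by []. Qed.

Lemma opp_ldivE x y z : opp_ldiv q x y = z <-> q y z = x.
Proof. exact: ldiv_opE. Qed.

Lemma opp_rdivE x y z : opp_rdiv q x y = z <-> q z x = y.
Proof. exact: rdiv_opE. Qed.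

End ParastropheSpecs.

Definition closed_under (Q : Type) (op : Q -> Q -> Q) (H : set Q) : Prop :=
  forall x y : Q, x \in H -> y \in H -> op x y \in H.

Definition restrict_op (Q : Type) (op : Q -> Q -> Q) (H : set Q)
    (clH : closed_under op H) (x y : set_type H) : set_type H :=
  SigSub (clH (val x) (val y) (valP x) (valP y)).

Definition is_subquasigroup (Q : Type) (q : quasigroup Q) (H : set Q) : Prop :=
  H !=set0 /\ exists clH : closed_under q H, is_quasigroup (restrict_op clH).

Record soft_set (A Q : Type) : Type := SoftSet {
  soft_fun :> A -> set Q;
  soft_fun_neq0 : forall a : A, soft_fun a !=set0 }.

Definition is_soft_quasigroup (A Q : Type) (q : quasigroup Q)
    (F : soft_set A Q) : Prop :=
  forall a : A, is_subquasigroup q (F a).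

(* Main.v *)
Require Import Defs.
From mathcomp Require Import all_boot.
From mathcomp Require Import boolp classical_sets.

(** A nonempty subset [H] is a subquasigroup exactly when it is closed under
    multiplication and both divisions: solutions of equations are unique in the
    ambient quasigroup, so a solution found inside [H] is the ambient quotient
    ([subquasigroupP]).  Now the multiplication and divisions of a parastrophe
    are, up to exchanging their arguments, a permutation of those of the
    original quasigroup, and closure does not see the order of the arguments.
    Hence the closure condition, and with it being a subquasigroup, is the same
    for all six parastrophes, and this applies to each value of the soft set. *)

Section Subquasigroups.
Variables (Q : Type) (H : set Q).
Implicit Type q : quasigroup Q.

(** Solvability inside [H] forces closure under the divisions because of the
    uniqueness of solutions in [Q]; conversely the quotients in [Q] are the
    required solutions in [H]. *)
Lemma subquasigroupP q :
  is_subquasigroup q H <->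
  [/\ (H !=set0)%classic, closed_under q H,
      closed_under (ldiv q) H & closed_under (rdiv q) H].
Proof.
split=> [[H0 [clH [_ solr soll]]]|[H0 clH clL clR]].
- split=> // x y xH yH.
  + have [z [/(congr1 val) zE _]] := solr (SigSub xH) (SigSub yH).
    by have /ldivE -> := zE; apply: valP.
  + have [z [/(congr1 val) zE _]] := soll (SigSub yH) (SigSub xH).
    by have /rdivE -> := zE; apply: valP.
- split=> //; exists clH; split.
  + by case: H0 => x /mem_set xH; split; exact: SigSub xH.
  + move=> a b; exists (SigSub (clL _ _ (valP a) (valP b))).
    split=> [|z /(congr1 val)/= /ldivE zE]; apply: val_inj => //=.
    exact/ldivE.
  + move=> a b; exists (SigSub (clR _ _ (valP b) (valP a))).
    split=> [|z /(congr1 val)/= /rdivE zE]; apply: val_inj => //=.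
    exact/rdivE.
Qed.

(** Needed because the divisions of [opp q], [ldiv q] and [rdiv q] often agree
    with an operation of [q] only after an exchange of arguments, as in
    [ldiv (opp q) x y = rdiv q y x]. *)
Lemma closed_under_swap (f g : Q -> Q -> Q) :
  (forall x y, f x y = g y x) -> closed_under f H = closed_under g H.
Proof.
move=> fg; apply/propext.
by split=> cl x y xH yH; [rewrite -fg | rewrite fg]; apply: cl.
Qed.

Lemma closed_under_ext (f g : Q -> Q -> Q) :
  (forall x y, f x y = g x y) -> closed_under f H = closed_under g H.
Proof.
move=> fg; apply/propext.
by split=> cl x y xH yH; [rewrite -fg | rewrite fg]; apply: cl.
Qed.

Lemma subquasigroup_opp q : is_subquasigroup (opp q) H <-> is_subquasigroup q H.
Proof.
have clM : closed_under (opp q) H = closed_under q H.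
  exact: closed_under_swap.
have clL : closed_under (ldiv (opp q)) H = closed_under (rdiv q) H.
  by apply: closed_under_swap => x y; apply/ldivE/oppE/rdivE.
have clR : closed_under (rdiv (opp q)) H = closed_under (ldiv q) H.
  by apply: closed_under_swap => x y; apply/rdivE/oppE/ldivE.
by rewrite !subquasigroupP clM clL clR; split=> -[].
Qed.

Lemma subquasigroup_ldiv q :
  is_subquasigroup (ldiv q) H <-> is_subquasigroup q H.
Proof.
have clL : closed_under (ldiv (ldiv q)) H = closed_under q H.
  by apply: closed_under_ext => x y; apply/ldivE/ldivE.
have clR : closed_under (rdiv (ldiv q)) H = closed_under (rdiv q) H.
  by apply: closed_under_swap => x y; apply/rdivE/ldivE/rdivE.
by rewrite !subquasigroupP clL clR; split=> -[].
Qed.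

Lemma subquasigroup_rdiv q :
  is_subquasigroup (rdiv q) H <-> is_subquasigroup q H.
Proof.
have clL : closed_under (ldiv (rdiv q)) H = closed_under (ldiv q) H.
  by apply: closed_under_swap => x y; apply/ldivE/rdivE/ldivE.
have clR : closed_under (rdiv (rdiv q)) H = closed_under q H.
  by apply: closed_under_ext => x y; apply/rdivE/rdivE.
by rewrite !subquasigroupP clL clR; split=> -[].
Qed.

End Subquasigroups.

Theorem lemma3p1 (Q : Type) (q : quasigroup Q) (A : Type) (F : soft_set A Q) :
  [<-> is_soft_quasigroup q F;
       is_soft_quasigroup (opp q) F;
       is_soft_quasigroup (ldiv q) F;
       is_soft_quasigroup (rdiv q) F;
       is_soft_quasigroup (opp_ldiv q) F;
       is_soft_quasigroup (opp_rdiv q) F].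
Proof.
tfae=> sqF a; move: (sqF a).
- by move/subquasigroup_opp.
- by move/subquasigroup_opp/subquasigroup_ldiv.
- by move/subquasigroup_ldiv/subquasigroup_rdiv.
- by move/subquasigroup_rdiv/subquasigroup_ldiv/subquasigroup_opp.
- move/subquasigroup_opp/subquasigroup_ldiv.
  by move/subquasigroup_rdiv/subquasigroup_opp.
- by move/subquasigroup_opp/subquasigroup_rdiv.
Qed.
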